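(* Consider the multistage stochastic problem, the Bellman operators $\mathfrak B_t$, the value functions $V_t$, the sets $X_t$, the set-valued mappings $\mathcal U_t^w$, the selection functions and the Tropical Dynamic Programming (TDP) algorithm described in the context. Assume: (1) the noises $\mathbf W_1,\dots,\mathbf W_T$ are independent with finite supports; (2) for every $t\in\{0,\dots,T\}$ the set $X_t$ is nonempty and compact, and $x_0\in X_0$; (3) for every $t\in\{0,\dots,T-1\}$ and $w\in\mathrm{supp}(\mathbf W_{t+1})$, the functions $f_t^w$ and $c_t^w$ are Lipschitz continuous on $\mathrm{dom}\,c_t^w$, and there is a constant $L_{\mathcal U_t^w}>0$ such that $d_{\mathcal H}(\mathcal U_t^w(x_1),\mathcal U_t^w(x_2))\le L_{\mathcal U_t^w}\|x_1-x_2\|$ for all $x_1,x_2\in X_t$ (with $d_{\mathcal H}$ the Hausdorff distance); moreover $\psi$ is Lipschitz continuous on $X_T$; (4) for every $t\in\{0,\dots,T-1\}$, $w\in\mathrm{supp}(\mathbf W_{t+1})$ and $x\in X_t$, the set $\mathcal U_t^w(x)$ is nonempty and compact. Let $(\overline V_t^k)_{k\in\mathbb N}$ and $(\underline V_t^k)_{k\in\mathbb N}$, $t\in\{0,\dots,T\}$, be the approximations generated by TDP, let $(x_t^k)_{0\le t\le T}$ be the problem-child trajectory computed at iteration $k$, and let $\overline V_t^*=\lim_k\overline V_t^k$ and $\underline V_t^*=\lim_k\underline V_t^k$ be the limits on $X_t$. Then for every $t\in\{0,\dots,T\}$, $$\overline V_t^k(x_t^k)-\underline V_t^k(x_t^k)\underset{k\to+\infty}{\longrightarrow}0,$$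 and for every accumulation point $x_t^*$ of the sequence $(x_t^k)_{k\in\mathbb N}$, $$\overline V_t^*(x_t^* )=\underline V_t^*(x_t^* ).$$
   Context: Setting. $T\ge1$, $\mathbb X=\mathbb R^n$, $\mathbb U=\mathbb R^m$ with Euclidean norms; $x_0\in\mathbb X$ is a given initial state. $\mathbf W_t$ ($t=1,\dots,T$) is a random variable with values in a measurable set $\mathbb W_t$, with finite support $\mathrm{supp}(\mathbf W_t)=\{w:\mathbb P(\mathbf W_t=w)>0\}$ carrying all the probability mass. For $t\in\{0,\dots,T-1\}$ and $w\in\mathrm{supp}(\mathbf W_{t+1})$: dynamics $f_t^w:\mathbb X\times\mathbb U\to\mathbb X$ and cost $c_t^w:\mathbb X\times\mathbb U\to\mathbb R\cup\{+\infty\}$; final cost $\psi:\mathbb X\to\mathbb R\cup\{+\infty\}$. $\mathrm{dom}\,g=\{g<+\infty\}$. Sets. $X_T=\mathrm{dom}\,\psi$ and, for $t<T$, $X_t=\bigcap_{w\in\mathrm{supp}(\mathbf W_{t+1})}\pi_{\mathbb X}(\mathrm{dom}\,c_t^w)$, where $\pi_{\mathbb X}(x,u)=x$. For $t<T$, $\mathcal U_t^w(x)=\{u\in\mathbb U: c_t^w(x,u)<+\infty\text{ and }f_t^w(x,u)\in X_{t+1}\}$. Bellman operators. For $\phi:\mathbb X\to\overline{\mathbb R}$, $\mathcal B_t^w(\phi)(x)=\inf_{u\in\mathbb U}\big(c_t^w(x,u)+\phi(f_t^w(x,u))\big)$ and $\mathfrak B_t(\phi)(x)=\mathbb E[\mathcal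 B_t^{\mathbf W_{t+1}}(\phi)(x)]$. Value functions: $V_T=\psi$, $V_t=\mathfrak B_t(V_{t+1})$ for $t<T$. Under the hypotheses of the claim, $\mathrm{dom}\,V_t=X_t$ and $V_t$ is Lipschitz continuous on $X_t$; fix for each $t$ a constant $L_{V_t}>0$ such that $V_t$ is $L_{V_t}$-Lipschitz on $X_t$. Basic functions. A basic function at time $t$ is a function $\phi:\mathbb X\to\mathbb R\cup\{+\infty\}$ that is real-valued and $L_{V_t}$-Lipschitz continuous on $X_t$ and equals $+\infty$ outside $X_t$. Let $\overline{\mathbf F}_t$ and $\underline{\mathbf F}_t$ be given sets of basic functions at time $t$. For $F\subset\overline{\mathbf F}_t$ put $\overline{\mathcal V}_F=\inf_{\phi\in F}\phi$; for $F\subset\underline{\mathbf F}_t$ put $\underline{\mathcal V}_F=\sup_{\phi\in F}\phi$ (pointwise). Selection functions. For $t<T$, an upper selection function $\overline S_t$ assigns to each nonempty finite $F\subset\overline{\mathbf F}_{t+1}$ and $x\in X_t$ a function $\overline S_t(F,x)\in\overline{\mathbf F}_t$ such that $\overline S_t(F,x)(x)=\mathfrak B_t(\overline{\mathcal V}_F)(x)$ (tightness) and $\overline S_t(F,x)\ge\mathfrak B_t(\overline{\mathcal V}_F)$ on $X_t$ (validity). A lower selection function $\underline S_t$ assigns to each nonempty finite $F\subset\underline{\mathbf F}_{t+1}$ and $x\in X_t$ a function $\underline S_t(F,x)\in\underline{\mathbf F}_t$ with $\underline S_t(F,x)(x)=\mathfrak B_t(\underline{\mathcal V}_F)(x)$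 and $\underline S_t(F,x)\le\mathfrak B_t(\underline{\mathcal V}_F)$ on $X_t$. For $t=T$, $\overline S_T:X_T\to\overline{\mathbf F}_T$ and $\underline S_T:X_T\to\underline{\mathbf F}_T$ satisfy $\overline S_T(x)(x)=\underline S_T(x)(x)=V_T(x)$, $\overline S_T(x)\ge V_T$ and $\underline S_T(x)\le V_T$ on $X_T$. Problem-child trajectory for functions $\overline\phi_0,\dots,\overline\phi_T$ and $\underline\phi_0,\dots,\underline\phi_T$: set $x_0^*=x_0$; for $t=0,\dots,T-1$, for each $w\in\mathrm{supp}(\mathbf W_{t+1})$ choose $u_t^w\in\arg\min_{u\in\mathbb U}\big(c_t^w(x_t^*,u)+\underline\phi_{t+1}(f_t^w(x_t^*,u))\big)$; choose $w^*\in\arg\max_{w\in\mathrm{supp}(\mathbf W_{t+1})}(\overline\phi_{t+1}-\underline\phi_{t+1})(f_t^w(x_t^*,u_t^w))$; set $x_{t+1}^*=f_t^{w^*}(x_t^*,u_t^{w^*})$. All ties are broken arbitrarily. TDP algorithm. Given upper and lower selection functions $\overline S_t,\underline S_t$ for all $t$, set $\overline F_t^0=\underline F_t^0=\emptyset$. For $k=0,1,2,\dots$: (forward) compute the problem-child trajectory $(x_t^k)_{0\le t\le T}$ for $(\overline V_t^k)_t$ and $(\underline V_t^k)_t$, where $\overline V_t^k=\inf_{\phi\in\overline F_t^k}\phi$ and $\underline V_t^k=\sup_{\phi\in\underline F_t^k}\phi$; (backward) set $\overline F_T^{k+1}=\overline F_T^k\cup\{\overline S_T(x_T^k)\}$,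 $\underline F_T^{k+1}=\underline F_T^k\cup\{\underline S_T(x_T^k)\}$, and for $t=T-1,\dots,0$, $\overline F_t^{k+1}=\overline F_t^k\cup\{\overline S_t(\overline F_{t+1}^{k+1},x_t^k)\}$, $\underline F_t^{k+1}=\underline F_t^k\cup\{\underline S_t(\underline F_{t+1}^{k+1},x_t^k)\}$. Convention for the initial iteration $k=0$, where no approximation is available: the trajectory $(x_t^0)_t$ is any trajectory with $x_0^0=x_0$ and $x_{t+1}^0=f_t^{w}(x_t^0,u)$ for some $w\in\mathrm{supp}(\mathbf W_{t+1})$ and $u\in\mathcal U_t^{w}(x_t^0)$. For $k\ge1$ the functions $\overline V_t^k,\underline V_t^k$ are real-valued on $X_t$ and are respectively nonincreasing and nondecreasing in $k$; $\overline V_t^*$, $\underline V_t^*$ denote their limits on $X_t$. *)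

(* Defs.v *)
From HB Require Import structures.
From mathcomp Require Export all_boot all_order all_algebra.
From mathcomp Require Export all_classical all_reals all_analysis.

Set Implicit Arguments.
Unset Strict Implicit.
Unset Printing Implicit Defensive.

Import Order.TTheory GRing.Theory Num.Theory.
Import numFieldNormedType.Exports.

Local Open Scope classical_set_scope.
Local Open Scope ring_scope.

(* The library norm on matrices is the sup norm; its topology on ['rV[R]_n]
   (used for compactness and accumulation points) is the Euclidean one. *)
Definition enorm (R : realType) (n : nat) (v : 'rV[R]_n) : R :=
  Num.sqrt (\sum_(i < n) v 0 i ^+ 2).

(* Euclidean norm on R^n x R^m = R^(n + m) *)
Definition enorm2 (R : realType) (n m : nat) (z : 'rV[R]_n * 'rV[R]_m) : R :=
  enorm (row_mx z.1 z.2).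

Definition edom (R : realType) (A : Type) (g : A -> \bar R) : set A :=
  [set a | (g a < +oo)%E].

(* [g] is real-valued on [D] and [L]-Lipschitz there, for the norm [N] on the
   source. *)
Definition elipschitz_on (R : realType) (V : zmodType) (N : V -> R) (L : R)
    (D : set V) (g : V -> \bar R) : Prop :=
  (forall x, D x -> g x \is a fin_num) /\
  (forall x y, D x -> D y -> `|fine (g x) - fine (g y)| <= L * N (x - y)).

Definition lipschitz_on2 (R : realType) (n m p : nat) (L : R)
    (D : set ('rV[R]_n * 'rV[R]_m)) (f : 'rV[R]_n * 'rV[R]_m -> 'rV[R]_p) :
    Prop :=
  forall z1 z2, D z1 -> D z2 -> enorm (f z1 - f z2) <= L * enorm2 (z1 - z2).

Definition dist_to_set (R : realType) (n : nat) (a : 'rV[R]_n)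
    (B : set 'rV[R]_n) : \bar R :=
  ereal_inf [set (enorm (a - b))%:E | b in B].

Definition hausdorff_dist (R : realType) (n : nat) (A B : set 'rV[R]_n) :
    \bar R :=
  maxe (ereal_sup [set dist_to_set a B | a in A])
       (ereal_sup [set dist_to_set b A | b in B]).

(* Expectation of an extended-real random variable, with the convention
   (+oo) + (-oo) = +oo, usual in minimization: [%dE] is the library's dual
   addition, which satisfies it, whereas the library integral uses
   (+oo) + (-oo) = -oo. *)
Definition eexpectation (R : realType) (d : measure_display)
    (Omega : measurableType d) (P : probability Omega R)
    (Y : Omega -> \bar R) : \bar R :=
  ((\int[P]_o (Y^\+ o))%E - (\int[P]_o (Y^\- o))%E)%dE.

(* Data of a multistage stochastic problem with states in R^n and controls in
   R^m. Only [noise t] for 1 <= t <= horizon, and [dyn t w], [cost t w] for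
   t < horizon and w in the support of [noise t.+1], are meaningful. *)
Record msp (R : realType) (n m : nat) (d : measure_display)
    (Omega : measurableType d) (P : probability Omega R)
    (dW : nat -> measure_display) (W : forall t, measurableType (dW t)) := MSP {
  horizon : nat;
  noise : forall t, {RV P >-> W t};
  dyn : forall t, W t.+1 -> 'rV[R]_n * 'rV[R]_m -> 'rV[R]_n;
  cost : forall t, W t.+1 -> 'rV[R]_n * 'rV[R]_m -> \bar R;
  final_cost : 'rV[R]_n -> \bar R;
  init_state : 'rV[R]_n
}.
Arguments noise {R n m d Omega P dW W} _ t.

Section Problem.
Context {R : realType} {n m : nat} {d : measure_display}.
Context {Omega : measurableType d} {P : probability Omega R}.
Context {dW : nat -> measure_display} {W : forall t, measurableType (dW t)}.

Local Notation X := 'rV[R]_n.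
Local Notation U := 'rV[R]_m.
Local Notation xfun := (X -> \bar R).

Implicit Types (p : msp n m P W) (t : nat) (phi : xfun) (F : set xfun).

Definition supp p t : set (W t) :=
  [set w | (0 < P (noise p t @^-1` [set w]))%E].
Arguments supp p t _ : clear implicits.

(* The measurability clause is what makes P(noise t = w) meaningful. *)
Definition finitely_supported p t : Prop :=
  [/\ forall w, measurable (noise p t @^-1` [set w]),
      finite_set (supp p t) &
      P (noise p t @^-1` supp p t) = 1%E].

(* Subfamilies are covered by taking [A t = setT]. *)
Definition independent_noises p : Prop :=
  forall A : forall t, set (W t), (forall t, measurable (A t)) ->
  P (\bigcap_(t in [set t | (1 <= t <= horizon p)%N]) noise p t @^-1` A t) =
  (\prod_(1 <= t < (horizon p).+1) P (noise p t @^-1` A t))%E.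

Definition Xset p t : set X :=
  if (t < horizon p)%N then
    \bigcap_(w in supp p t.+1) (fst @` edom (cost p w))
  else edom (final_cost p).

Definition Uset p t (w : W t.+1) (x : X) : set U :=
  [set u | (cost p w (x, u) < +oo)%E /\ Xset p t.+1 (dyn p w (x, u))].

Definition stage_cost p t (w : W t.+1) phi (x : X) (u : U) : \bar R :=
  (cost p w (x, u) + phi (dyn p w (x, u)))%dE.

Definition bellman_at p t (w : W t.+1) phi (x : X) : \bar R :=
  ereal_inf (range (stage_cost p w phi x)).

Definition bellman p t phi (x : X) : \bar R :=
  eexpectation P (fun o => bellman_at p (noise p t.+1 o) phi x).

(* [value_to_go p k] is the value function at time [horizon p - k]. *)
Fixpoint value_to_go p (k : nat) : xfun :=
  if k is k'.+1 then bellman p (horizon p - k'.+1) (value_to_go p k')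
  else final_cost p.

Definition value p t : xfun := value_to_go p (horizon p - t).

Definition basic p (LV : nat -> R) t phi : Prop :=
  elipschitz_on (@enorm R n) (LV t) (Xset p t) phi /\
  (forall x, ~ Xset p t x -> phi x = +oo%E).

Definition inf_of F : xfun := fun x => ereal_inf [set phi x | phi in F].
Definition sup_of F : xfun := fun x => ereal_sup [set phi x | phi in F].

Section Selection.
Variables (p : msp n m P W) (Fbar Flow : nat -> set xfun).

Definition upper_selection t (S : set xfun -> X -> xfun) : Prop :=
  forall F x, finite_set F -> F !=set0 -> F `<=` Fbar t.+1 -> Xset p t x ->
  [/\ Fbar t (S F x),
      S F x x = bellman p t (inf_of F) x &
      forall y, Xset p t y -> (bellman p t (inf_of F) y <= S F x y)%E].

Definition lower_selection t (S : set xfun -> X -> xfun) : Prop :=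
  forall F x, finite_set F -> F !=set0 -> F `<=` Flow t.+1 -> Xset p t x ->
  [/\ Flow t (S F x),
      S F x x = bellman p t (sup_of F) x &
      forall y, Xset p t y -> (S F x y <= bellman p t (sup_of F) y)%E].

Definition upper_selection_final (S : X -> xfun) : Prop :=
  forall x, Xset p (horizon p) x ->
  [/\ Fbar (horizon p) (S x),
      S x x = value p (horizon p) x &
      forall y, Xset p (horizon p) y -> (value p (horizon p) y <= S x y)%E].

Definition lower_selection_final (S : X -> xfun) : Prop :=
  forall x, Xset p (horizon p) x ->
  [/\ Flow (horizon p) (S x),
      S x x = value p (horizon p) x &
      forall y, Xset p (horizon p) y -> (S x y <= value p (horizon p) y)%E].

End Selection.

(* [x] is one of the problem-child trajectories: every way of breaking ties in
   the argmin and argmax is allowed. *)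
Definition problem_child p (phibar philow : nat -> xfun) (x : nat -> X) : Prop :=
  x 0%N = init_state p /\
  forall t, (t < horizon p)%N ->
  exists (u : W t.+1 -> U) (ws : W t.+1),
    [/\ forall w, supp p t.+1 w -> forall v,
          (stage_cost p w (philow t.+1) (x t) (u w) <=
           stage_cost p w (philow t.+1) (x t) v)%E,
        supp p t.+1 ws,
        forall w, supp p t.+1 w ->
          (phibar t.+1 (dyn p w (x t, u w)) -
             philow t.+1 (dyn p w (x t, u w)) <=
           phibar t.+1 (dyn p ws (x t, u ws)) -
             philow t.+1 (dyn p ws (x t, u ws)))%E &
        x t.+1 = dyn p ws (x t, u ws)].

Definition admissible_trajectory p (x : nat -> X) : Prop :=
  x 0%N = init_state p /\
  forall t, (t < horizon p)%N ->
  exists (w : W t.+1) (u : U),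
    [/\ supp p t.+1 w, Uset p w (x t) u & x t.+1 = dyn p w (x t, u)].

(* [Fb k t] and [Fl k t] are the sets of upper and lower basic functions at
   time [t] before iteration [k], and [x k] is the trajectory computed at
   iteration [k]. *)
Record tdp_run p
    (Sbar Slow : nat -> set xfun -> X -> xfun) (SbarT SlowT : X -> xfun)
    (Fb Fl : nat -> nat -> set xfun) (x : nat -> nat -> X) : Prop := TDPRun {
  tdp_init : forall t, (t <= horizon p)%N -> Fb 0%N t = set0 /\ Fl 0%N t = set0;
  tdp_forward0 : admissible_trajectory p (x 0%N);
  tdp_forward : forall k, (0 < k)%N ->
    problem_child p (fun t => inf_of (Fb k t)) (fun t => sup_of (Fl k t)) (x k);
  tdp_backwardT : forall k,
    Fb k.+1 (horizon p) = Fb k (horizon p) `|` [set SbarT (x k (horizon p))] /\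
    Fl k.+1 (horizon p) = Fl k (horizon p) `|` [set SlowT (x k (horizon p))];
  tdp_backward : forall k t, (t < horizon p)%N ->
    Fb k.+1 t = Fb k t `|` [set Sbar t (Fb k.+1 t.+1) (x k t)] /\
    Fl k.+1 t = Fl k t `|` [set Slow t (Fl k.+1 t.+1) (x k t)]
}.

End Problem.

Arguments supp {R n m d Omega P dW W} p t _.

(* Main.v *)
(* Write gap^k_t for the difference between the upper and the lower
   approximation at time t before iteration k: it is nonnegative, nonincreasing
   in k, and 2 L_{V_t}-Lipschitz on X_t. Tightness of the selections at x_t^k,
   monotonicity of the Bellman operator, and the choice of the control and of
   the worst noise along the problem-child trajectory give
     gap^{k+1}_T (x_T^k) = 0  and
     gap^{k+1}_t (x_t^k) <= gap^k_{t+1} (x_{t+1}^k)  for t < T.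
   On the compact set X_t the decrements gap^k_t - gap^{k+1}_t tend to 0
   uniformly, so backward induction on t gives gap^k_t (x_t^k) --> 0. At an
   accumulation point, equicontinuity makes gap^k_t arbitrarily small for some
   k, and monotonicity makes its limit vanish. *)

Require Import Defs.
From mathcomp Require Import all_boot all_order all_algebra.
From mathcomp Require Import all_classical all_reals all_analysis.
From mathcomp Require Import measurable_realfun.
From mathcomp Require Import lra.
Import Order.TTheory GRing.Theory Num.Theory.
Import numFieldNormedType.Exports.
Local Open Scope classical_set_scope.
Local Open Scope ring_scope.

Import DualAddTheory.

(** * Expectation of extended-real variables that may fail to be measurable *)

Section expectation.
Local Open Scope ereal_scope.
Context {d : measure_display} {T : measurableType d} {R : realType}.
Import HBNNSimple.

(* No measurability is assumed, so the comparison is made on the simple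
   functions below [f], cut off to [A]. *)
Lemma ge0_le_integral_cofull (mu : {measure set T -> \bar R}) (A : set T)
    (f g : T -> \bar R) :
  measurable A -> mu (~` A) = 0 ->
  (forall x, 0 <= f x) -> (forall x, 0 <= g x) ->
  (forall x, A x -> f x <= g x) ->
  \int[mu]_x f x <= \int[mu]_x g x.
Proof.
move=> mA A0 f0 g0 fg; rewrite !ge0_integralTE//.
apply: ge_ereal_sup => _ [h /= hf <-].
have -> : sintegral mu (h) =
    sintegral mu (proj_nnsfun h mA).
  rewrite -!integralT_nnsfun -mrestrict; apply: ge0_ae_eq_integral => //.
  - by apply/measurable_EFinP; exact: measurable_funP.
  - by rewrite mrestrict; apply/measurable_EFinP; exact: measurable_funP.
  - by move=> x _; rewrite lee_fin; exact: fun_ge0.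
  - by move=> x _; rewrite mrestrict lee_fin; exact: fun_ge0.
  exists (~` A); split => //; first exact: measurableC.
  by move=> x /= + Ax; apply => _; rewrite patchE mem_set.
apply: ereal_sup_ubound; exists (proj_nnsfun h mA) => // x.
rewrite -mrestrict patchE; case: ifPn => [/set_mem Ax|_] //.
exact: le_trans (hf x) (fg x Ax).
Qed.

(** On [A] the positive part grows and the negative part shrinks from [Y] to [Z]; the dual
    subtraction is monotone in this sense even at infinite values. *)
Lemma le_eexpectation_cofull (P : probability T R) (A : set T)
    (Y Z : T -> \bar R) :
  measurable A -> P A = 1 -> (forall o, A o -> Y o <= Z o) ->
  eexpectation P Y <= eexpectation P Z.
Proof.
move=> mA A1 YZ.
have A0 : P (~` A) = 0 by rewrite probability_setC// A1 subee.
rewrite /eexpectation; apply: lee_dB.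
  apply: (ge0_le_integral_cofull _ _ _ _ mA) => // o Ao.
  by rewrite !funeposE le_max2 ?YZ.
apply: (ge0_le_integral_cofull _ _ _ _ mA) => // o Ao.
by rewrite !funenegE le_max2 // leeN2 YZ.
Qed.

Lemma le_eexpectation (P : probability T R) (Y Z : T -> \bar R) :
  (forall o, Y o <= Z o) -> eexpectation P Y <= eexpectation P Z.
Proof.
by move=> YZ; apply: (le_eexpectation_cofull _ _ _ _ measurableT);
  rewrite ?probability_setT.
Qed.

(** Both parts have finite integrals, and there the dual subtraction agrees with the usual one. *)
Lemma eexpectation_integral (P : probability T R) (Y : T -> \bar R) :
  P.-integrable setT Y -> eexpectation P Y = \int[P]_o Y o.
Proof.
move=> iY; rewrite /eexpectation [RHS]integralE.
have := integral_funepos_lt_pinfty measurableT iY.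
have := integral_funeneg_lt_pinfty measurableT iY.
have : 0 <= \int[P]_x Y^\- x by exact: integral_ge0.
have : 0 <= \int[P]_x Y^\+ x by exact: integral_ge0.
by case: (\int[P]_x Y^\+ x) => [a| |]; case: (\int[P]_x Y^\- x) => [b| |].
Qed.

Lemma eexpectationD_cst (P : probability T R) (Y : T -> \bar R) (r : R) :
  P.-integrable setT Y ->
  eexpectation P (fun o => Y o + r%:E) = eexpectation P Y + r%:E.
Proof.
move=> iY.
have ir : P.-integrable setT (cst r%:E : T -> \bar R).
  exact: finite_measure_integrable_cst.
rewrite !eexpectation_integral//; last exact: integrableD.
by rewrite integralD// integral_cst//= probability_setT mule1.
Qed.

End expectation.

(** * Expectations under finitely supported noise *)

Section finite_noise.
Local Open Scope ereal_scope.
Context {d d' : measure_display} {T : measurableType d} {R : realType}.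
Context {E : measurableType d'}.
Variables (P : probability T R) (N : T -> E) (S : set E).
Hypothesis mN : forall w, measurable (N @^-1` [set w]).
Hypothesis finS : finite_set S.
Hypothesis PS : P (N @^-1` S) = 1.

Lemma measurable_preimage_finite : measurable (N @^-1` S).
Proof.
have -> : N @^-1` S = \bigcup_(w in S) (N @^-1` [set w]).
  by apply/seteqP; split=> [x Sx|x [w Sw /= ->]//]; exists (N x).
by apply: fin_bigcup_measurable => // w _; exact: mN.
Qed.

(** The composite [g \o N] need not be measurable, since [g] is arbitrary off [S]. The witness takes
    the value [g w] on each event [N = w] with [w] in [S], and 0 elsewhere. *)
Lemma integrable_finite_noise (g : E -> \bar R) :
  (forall w, S w -> g w \is a fin_num) ->
  exists2 Y : T -> \bar R, P.-integrable setT Y &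
    forall o, S (N o) -> Y o = g (N o).
Proof.
move=> gS; pose s := finmap.enum_fset (fset_set S).
exists (fun o => \sum_(w <- s) ((fine (g w))%:E * (\1_(N @^-1` [set w]) o)%:E)).
  apply: integrable_sum => // w _.
  apply: integrableZl => //.
  exact: integrable_indic.
move=> o So.
have No : N o \in s by rewrite in_fset_set//; exact/mem_set.
rewrite (bigD1_seq (N o)) ?finmap.fset_uniq//=.
rewrite indicE mem_set//= mule1 fineK ?gS// big1 ?adde0// => w wN.
by rewrite indicE memNset ?mule0// => /= /esym /eqP; rewrite (negbTE wN).
Qed.

(** The integrable copy [Y] of [g1 \o N] stands between the two sides: [r] can be pulled out of its
    expectation, and it agrees with [g1 \o N] on an event of probability one. *)
Lemma eexpectation_le_add (g1 g2 : E -> \bar R) (r : R) :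
  (forall w, S w -> g1 w \is a fin_num) ->
  (forall w, S w -> g2 w <= g1 w + r%:E) ->
  eexpectation P (g2 \o N) <= eexpectation P (g1 \o N) + r%:E.
Proof.
move=> g1S g12; have [Y iY YE] := integrable_finite_noise _ g1S.
have mS := measurable_preimage_finite.
apply: (@le_trans _ _ (eexpectation P (fun o => Y o + r%:E))).
  by apply: (le_eexpectation_cofull _ _ _ _ mS PS) => o So; rewrite YE ?g12.
rewrite eexpectationD_cst// leeD2r//.
by apply: (le_eexpectation_cofull _ _ _ _ mS PS) => o So; rewrite YE.
Qed.

End finite_noise.

(** * Extrema of finite sets are attained *)

Section finite_extrema.
Context {R : realType}.
Implicit Type A : set (\bar R).

Lemma finite_ereal_sup_in A : finite_set A -> A !=set0 -> A (ereal_sup A).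
Proof.
move=> /finite_seqP[s ->] [x /= xs].
suff [y ys ymax] : exists2 y, y \in s & forall z, z \in s -> (z <= y)%E.
  suff -> : ereal_sup [set` s] = y by [].
  apply/eqP; rewrite eq_le ereal_sup_ubound// andbT.
  exact: ge_ereal_sup.
elim: s x xs => // a s IH x _; case: s IH => [_|b s IH].
  by exists a; rewrite ?mem_head// => z; rewrite inE => /eqP ->.
have [y ys ymax] := IH b (mem_head _ _).
have [ay|ya] := leP a y.
  exists y => [|z]; first by rewrite inE ys orbT.
  by rewrite inE => /orP[/eqP -> //|/ymax].
exists a => [|z]; first exact: mem_head.
by rewrite inE => /orP[/eqP -> //|/ymax zy]; exact: le_trans zy (ltW ya).
Qed.

Lemma finite_ereal_inf_in A : finite_set A -> A !=set0 -> A (ereal_inf A).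
Proof.
move=> finA A0; rewrite ereal_infEN.
have [] := finite_ereal_sup_in (-%E @` A); first exact: finite_image.
- exact: image_nonempty.
- by move=> z Az <-; rewrite oppeK.
Qed.

End finite_extrema.

(** * The Euclidean norm against the sup-norm topology *)

Section euclidean_norm.
Context {R : realType} {n : nat}.
Implicit Types x y : 'rV[R]_n.

Lemma enormB x y : enorm (x - y) = enorm (y - x).
Proof.
by congr Num.sqrt; apply: eq_bigr => i _; rewrite !mxE -sqrrN opprB.
Qed.

Lemma enorm_le_norm x : enorm x <= Num.sqrt n%:R * `|x|.
Proof.
rewrite -[`|x|]ger0_norm// -sqrtr_sqr -sqrtrM// ler_wsqrtr//.
rewrite -[X in (X%:R * _)]card_ord -sumr_const mulr_suml.
apply: ler_sum => i _; rewrite mul1r -real_normK ?num_real//.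
rewrite lerXn2r ?nnegrE// [leRHS]mx_normrE.
exact: (le_bigmax _ (fun ij : _ * _ => `|x ij.1 ij.2|) (0, i)).
Qed.

Lemma near_enorm_lt x (e : R) : 0 < e -> \forall y \near x, enorm (y - x) < e.
Proof.
(* The [+ 1] keeps this factor positive when [n = 0], so that it can be a divisor. *)
move=> e0; have s0 : 0 < Num.sqrt n%:R + 1 :> R by rewrite ltr_wpDl// sqrtr_ge0.
near=> y; apply: le_lt_trans (enorm_le_norm _) _.
apply: (@le_lt_trans _ _ ((Num.sqrt n%:R + 1) * `|y - x|)).
  by rewrite ler_wpM2r// lerDl.
rewrite mulrC -ltr_pdivlMr//; near: y; apply/nbhs_ballP.
exists (e / (Num.sqrt n%:R + 1)); first by rewrite /= divr_gt0.
by move=> y; rewrite -ball_normE /= distrC.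
Unshelve. all: by end_near. Qed.

End euclidean_norm.

(** * Monotone sequences of equi-Lipschitz functions on a compact set *)

Section equilipschitz.
Context {R : realType} {n : nat}.
Variables (K : set 'rV[R]_n) (L : R) (g : nat -> 'rV[R]_n -> R).
Hypothesis L_gt0 : 0 < L.
Hypothesis g_lip : forall k x y, K x -> K y ->
  g k x <= g k y + L * enorm (x - y).
Hypothesis g_ge0 : forall k x, K x -> 0 <= g k x.
Hypothesis g_ni : forall k x, K x -> g k.+1 x <= g k x.

(* Pointwise the decrements tend to 0 because [g] is monotone and bounded;
   compactness and the common Lipschitz constant make this uniform. *)
Lemma decrements_unif_cvg0 (e : R) : compact K -> 0 < e ->
  \forall k \near \oo, forall x, K x -> g k x - g k.+1 x < e.
Proof.
move=> /compact_near_coveringP/near_covering_withinP cK e0.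
apply: (cK nat \oo (fun k x => g k x - g k.+1 x < e)) => x Kx.
have cg : cvgn (g ^~ x).
  apply: nonincreasing_is_cvgn.
    by apply/nonincreasing_seqP => k; exact: g_ni.
  by exists 0 => _ [k _ <-]; exact: g_ge0.
have dg : g k x - g k.+1 x @[k --> \oo] --> (0 : R).
  rewrite -(subrr (limn (g ^~ x))); apply: cvgB => //.
  by rewrite (cvg_shiftS (g ^~ x)).
have e3 : 0 < e / 3 by rewrite divr_gt0.
have eL : 0 < e / 3 / L by rewrite divr_gt0.
(* Going from [y] to [x] uses the Lipschitz bound twice, at [k] and at [k.+1]. Each use costs less
   than [e / 3], as does the decrement at [x]. *)
exists ([set y | enorm (y - x) < e / 3 / L],
        [set k | g k x - g k.+1 x < e / 3]) => /=.
  split; first exact: near_enorm_lt.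
  by have /cvgr0_norm_lt /(_ _ e3) := dg; apply: filterS => k;
     exact: le_lt_trans (ler_norm _).
move=> [y k] /= [yx gk] Ky.
have := g_lip k y x Ky Kx; have := g_lip k.+1 x y Kx Ky.
rewrite (enormB x y); move: yx; rewrite ltr_pdivlMr// mulrC.
lra.
Qed.

(** At a late index where [x k] is close to [xs], half of [e] bounds [g k (x k)] and the other half
    pays for the Lipschitz move from [x k] to [xs]. *)
Lemma cluster_seq_cvg0 (x : nat -> 'rV[R]_n) (xs : 'rV[R]_n) :
  K xs -> (forall k, K (x k)) -> g k (x k) @[k --> \oo] --> 0 ->
  (forall N B, nbhs xs B -> exists2 k, (N <= k)%N & B (x k)) ->
  forall e, 0 < e -> exists k, g k xs < e.
Proof.
move=> Kxs Kx gx xsP e e0.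
have e2 : 0 < e / 2 by rewrite divr_gt0.
have [N _ NP] : \forall k \near \oo, `|g k (x k)| < e / 2.
  exact: cvgr0_norm_lt.
have [|k Nk] := xsP N [set y | enorm (y - xs) < e / 2 / L].
  by apply: near_enorm_lt; rewrite divr_gt0.
rewrite /= ltr_pdivlMr// mulrC => yx; exists k.
have := g_lip k _ _ Kxs (Kx k); rewrite enormB.
have := NP k Nk; rewrite ger0_norm; last exact: g_ge0.
lra.
Qed.

End equilipschitz.

(** * Cluster points and backward induction over time *)

Lemma cluster_seq_frequently (V : topologicalType) (u : nat -> V) (v : V) :
  cluster (u k @[k --> \oo]) v ->
  forall N B, nbhs v B -> exists2 k, (N <= k)%N & B (u k).
Proof.
(* The image of the tail from [N] on belongs to the image filter, hence meets [B]. *)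
move=> uv N B Bv; have [] := uv [set u k | k in [set k | (N <= k)%N]] B _ Bv.
  by exists N => // k /= Nk; exists k.
by move=> _ [[k /= Nk <-] Bk]; exists k.
Qed.

Lemma decreasing_ind (T : nat) (Q : nat -> Prop) :
  Q T -> (forall t, (t < T)%N -> Q t.+1 -> Q t) ->
  forall t, (t <= T)%N -> Q t.
Proof.
move=> QT QS t tT; rewrite -(subKn tT).
elim: (T - t)%N (leq_subr t T) => [|s IH] sT; first by rewrite subn0.
apply: QS; last by rewrite subnSK//; exact: IH (ltnW sT).
by rewrite ltn_subrL /= (leq_ltn_trans _ sT).
Qed.

(** The convergence argument freed of probability: [g k t] at [x k t] is a decrement plus [g k.+1 t]
    at the same point, and the latter is controlled by the next time. *)
Lemma gap_cvg0 {R : realType} {n : nat} (T : nat) (K : nat -> set 'rV[R]_n)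
    (L : nat -> R) (g : nat -> nat -> 'rV[R]_n -> R)
    (x : nat -> nat -> 'rV[R]_n) :
  (forall t, (t <= T)%N -> compact (K t)) ->
  (forall t, (t <= T)%N -> 0 < L t) ->
  (forall k t y z, (t <= T)%N -> K t y -> K t z ->
    g k t y <= g k t z + L t * enorm (y - z)) ->
  (forall k t y, (t <= T)%N -> K t y -> 0 <= g k t y) ->
  (forall k t y, (t <= T)%N -> K t y -> g k.+1 t y <= g k t y) ->
  (forall k t, (t <= T)%N -> K t (x k t)) ->
  (forall k, g k.+1 T (x k T) <= 0) ->
  (forall k t, (t < T)%N -> g k.+1 t (x k t) <= g k t.+1 (x k t.+1)) ->
  forall t, (t <= T)%N -> g k t (x k t) @[k --> \oo] --> 0.
Proof.
move=> cK L0 gL g0 gni Kx gT gS.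
have dec t e : (t <= T)%N -> 0 < e -> \forall k \near \oo, forall y, K t y ->
    g k t y - g k.+1 t y < e.
  move=> tT e0; apply: (@decrements_unif_cvg0 _ _ (K t) (L t) (fun k => g k t)).
  - exact: L0.
  - by move=> k y z; exact: gL.
  - by move=> k y; exact: g0.
  - by move=> k y; exact: gni.
  - exact: cK.
  - exact: e0.
apply: decreasing_ind => [|t tT IH]; apply/cvgr0Pnorm_lt => e e0.
  near=> k; rewrite ger0_norm; last by apply: g0 => //; exact: Kx.
  (* The point [x k T] moves with [k], so the bound on decrements has to be uniform over [K T]. *)
  have : g k T (x k T) - g k.+1 T (x k T) < e.
    by move: (Kx k T (leqnn T)); near: k;
      apply: filterS (dec T e (leqnn T) e0) => k + Kk; apply.
  have := gT k; lra.
have tT' := ltnW tT.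
have e2 : 0 < e / 2 by rewrite divr_gt0.
near=> k; rewrite ger0_norm; last by apply: g0 => //; exact: Kx.
have : g k t (x k t) - g k.+1 t (x k t) < e / 2.
  by move: (Kx k t tT'); near: k;
    apply: filterS (dec t _ tT' e2) => k + Kk; apply.
have : `|g k t.+1 (x k t.+1)| < e / 2.
  by near: k; exact: cvgr0_norm_lt.
rewrite ger0_norm; last by apply: g0 => //; exact: Kx.
have := gS k t tT; lra.
Unshelve. all: by end_near. Qed.

(** * Finite families of basic functions and Bellman operators *)

Section basic_functions.
Context {R : realType} {n m : nat} {d : measure_display}.
Context {Omega : measurableType d} {P : probability Omega R}.
Context {dW : nat -> measure_display} {W : forall t, measurableType (dW t)}.
Local Notation xfun := ('rV[R]_n -> \bar R).
Variables (p : msp n m P W) (LV : nat -> R).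
Implicit Types (t : nat) (F G : set xfun) (phi psi : xfun) (x y : 'rV[R]_n).

Lemma basic_fin_num t phi x : basic p LV t phi -> Xset p t x ->
  phi x \is a fin_num.
Proof. by move=> [[+ _] _]; apply. Qed.

Lemma basic_ltey t phi x : basic p LV t phi -> (phi x < +oo)%E -> Xset p t x.
Proof. by move=> bphi; apply: contraPP => Xx; rewrite bphi.2. Qed.

Lemma basic_lip t phi x y : basic p LV t phi -> Xset p t x -> Xset p t y ->
  fine (phi x) <= fine (phi y) + LV t * enorm (x - y).
Proof.
move=> [[_ philip] _] Xx Xy.
by have := philip _ _ Xx Xy; rewrite ler_norml => /andP[_];
  rewrite lerBlDl addrC.
Qed.

Lemma inf_of_attained F x : finite_set F -> F !=set0 ->
  exists2 phi, F phi & inf_of F x = phi x.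
Proof.
move=> finF F0.
have [] := finite_ereal_inf_in [set phi x | phi in F].
- exact: finite_image.
- exact: image_nonempty.
- by move=> phi Fphi E; exists phi.
Qed.

Lemma sup_of_attained F x : finite_set F -> F !=set0 ->
  exists2 phi, F phi & sup_of F x = phi x.
Proof.
move=> finF F0.
have [] := finite_ereal_sup_in [set phi x | phi in F].
- exact: finite_image.
- exact: image_nonempty.
- by move=> phi Fphi E; exists phi.
Qed.

Lemma inf_of_le F phi x : F phi -> (inf_of F x <= phi x)%E.
Proof. by move=> Fphi; apply: ereal_inf_lbound; exists phi. Qed.

Lemma sup_of_ge F phi x : F phi -> (phi x <= sup_of F x)%E.
Proof. by move=> Fphi; apply: ereal_sup_ubound; exists phi. Qed.

Lemma inf_of_subset F G x : F `<=` G -> (inf_of G x <= inf_of F x)%E.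
Proof. by move=> FG; apply/ereal_inf_le_tmp/image_subset. Qed.

Lemma sup_of_subset F G x : F `<=` G -> (sup_of F x <= sup_of G x)%E.
Proof. by move=> FG; apply/ereal_sup_le/image_subset. Qed.

(** A minimizing [phi] at [y] also bounds the infimum at [x] from above, so its Lipschitz constant
    carries over. *)
Lemma basic_inf_of t F : finite_set F -> F !=set0 -> F `<=` basic p LV t ->
  basic p LV t (inf_of F).
Proof.
move=> finF F0 Fb; split; last first.
  by move=> x Xx; have [phi /Fb bphi ->] := inf_of_attained F x finF F0;
    exact: bphi.2.
have fin x : Xset p t x -> inf_of F x \is a fin_num.
  move=> Xx; have [phi /Fb bphi ->] := inf_of_attained F x finF F0.
  exact: basic_fin_num bphi Xx.
have lip x y : Xset p t x -> Xset p t y ->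
    fine (inf_of F x) <= fine (inf_of F y) + LV t * enorm (x - y).
  move=> Xx Xy; have [phi Fphi ->] := inf_of_attained F y finF F0.
  apply: le_trans (basic_lip t phi x y (Fb _ Fphi) Xx Xy).
  apply: fine_le; [exact: fin| |exact: inf_of_le].
  exact: basic_fin_num (Fb _ Fphi) Xx.
split=> // x y Xx Xy; rewrite ler_norml lerBlDl lip// andbT.
by rewrite lerNl opprB lerBlDl enormB lip.
Qed.

(** Here the maximizing function is taken at [x]. An attained supremum also takes the value [+oo]
    off the state set, whereas an empty one would be [-oo]. *)
Lemma basic_sup_of t F : finite_set F -> F !=set0 -> F `<=` basic p LV t ->
  basic p LV t (sup_of F).
Proof.
move=> finF F0 Fb; split; last first.
  by move=> x Xx; have [phi /Fb bphi ->] := sup_of_attained F x finF F0;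
    exact: bphi.2.
have fin x : Xset p t x -> sup_of F x \is a fin_num.
  move=> Xx; have [phi /Fb bphi ->] := sup_of_attained F x finF F0.
  exact: basic_fin_num bphi Xx.
have lip x y : Xset p t x -> Xset p t y ->
    fine (sup_of F x) <= fine (sup_of F y) + LV t * enorm (x - y).
  move=> Xx Xy; have [phi Fphi ->] := sup_of_attained F x finF F0.
  apply: le_trans (basic_lip t phi x y (Fb _ Fphi) Xx Xy) _.
  rewrite lerD2r; apply: fine_le; [|exact: fin|exact: sup_of_ge].
  exact: basic_fin_num (Fb _ Fphi) Xy.
split=> // x y Xx Xy; rewrite ler_norml lerBlDl lip// andbT.
by rewrite lerNl opprB lerBlDl enormB lip.
Qed.

Lemma le_bellman t phi psi x : (forall y, (phi y <= psi y)%E) ->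
  (bellman p t phi x <= bellman p t psi x)%E.
Proof.
move=> phipsi; apply: le_eexpectation => o.
apply: le_ereal_inf_tmp => _ [u _ <-].
apply: (@le_trans _ _ (stage_cost p (noise p t.+1 o) phi x u)).
  by apply: ereal_inf_lbound; exists u.
by apply: lee_dD2l; exact: phipsi.
Qed.

Lemma bellman_at_argmin t (w : W t.+1) phi x u :
  (forall v, (stage_cost p w phi x u <= stage_cost p w phi x v)%E) ->
  bellman_at p w phi x = stage_cost p w phi x u.
Proof.
move=> umin; apply/eqP; rewrite eq_le ereal_inf_lbound /=; last by exists u.
by apply: le_ereal_inf_tmp => _ [v _ <-].
Qed.

(** A feasible control has stage cost below [+oo], hence so does the minimizer. Under dual addition
    both of its terms are then below [+oo], and for a basic function this places the successor in
    the next state set. *)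
Lemma argmin_in_Uset t (w : W t.+1) phi x u :
  basic p LV t.+1 phi -> Uset p w x !=set0 ->
  (forall v, (stage_cost p w phi x u <= stage_cost p w phi x v)%E) ->
  Uset p w x u.
Proof.
move=> bphi [v [cv Xv]] /(_ v).
have : (stage_cost p w phi x v < +oo)%E.
  move: cv (basic_fin_num t.+1 phi _ bphi Xv); rewrite /stage_cost.
  by case: (cost p w (x, v)) => [a| |]; case: (phi _) => [b| |] //=;
    rewrite ?ltry ?ltNyr.
move=> /[swap]/le_lt_trans/[apply]; rewrite /stage_cost => h.
split; last apply: (basic_ltey _ phi) => //; move: h.
  by case: (cost p w (x, u)) => [a| |]; case: (phi _) => [b| |] //=;
    rewrite ?ltry.
by case: (cost p w (x, u)) => [a| |]; case: (phi _) => [b| |] //=;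
  rewrite ?ltry.
Qed.

(* Evaluating the upper stage cost at the minimizer of the lower one bounds the
   gap of the Bellman images by the expected gap at the successor states. *)
Lemma bellman_le_add t phib phil x (u : W t.+1 -> 'rV[R]_m) (r : R) :
  finitely_supported p t.+1 ->
  (forall w, supp p t.+1 w -> (-oo < cost p w (x, u w))%E) ->
  basic p LV t.+1 phib -> basic p LV t.+1 phil ->
  (forall w, supp p t.+1 w -> Uset p w x (u w)) ->
  (forall w, supp p t.+1 w -> forall v,
     (stage_cost p w phil x (u w) <= stage_cost p w phil x v)%E) ->
  (forall w, supp p t.+1 w ->
     (phib (dyn p w (x, u w)) - phil (dyn p w (x, u w)) <= r%:E)%E) ->
  (bellman p t phib x <= bellman p t phil x + r%:E)%E.
Proof.
move=> [mN finS PS] cNy bb bl uU umin gap.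
apply: (eexpectation_le_add P (noise p t.+1) (supp p t.+1) mN finS PS
  (fun w => bellman_at p w phil x) (fun w => bellman_at p w phib x)) => w Sw.
  (* The lower Bellman value is finite: the control is feasible, the cost is above [-oo], and [phil]
     is finite at the successor. *)
  rewrite (bellman_at_argmin _ _ _ _ _ (umin w Sw)) /stage_cost.
  have [cu Xu] := uU w Sw.
  move: (cNy w Sw) cu (basic_fin_num _ _ _ bl Xu).
  by case: (cost p w (x, u w)) => [a| |]; case: (phil _) => [b| |].
rewrite (bellman_at_argmin _ _ _ _ _ (umin w Sw)).
apply: (@le_trans _ _ (stage_cost p w phib x (u w))).
  by apply: ereal_inf_lbound; exists (u w).
rewrite /stage_cost; have [cu Xu] := uU w Sw.
move: (cNy w Sw) cu (basic_fin_num _ _ _ bl Xu)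
  (basic_fin_num _ _ _ bb Xu) (gap w Sw).
case: (cost p w (x, u w)) => [a| |]; case: (phil _) => [b| |];
  case: (phib _) => [c| |] // _ _ _ _.
rewrite /= !lee_fin; lra.
Qed.

End basic_functions.

(** * Invariants of a TDP run *)

Section tdp.
Context {R : realType} {n m : nat} {d : measure_display}.
Context {Omega : measurableType d} {P : probability Omega R}.
Context {dW : nat -> measure_display} {W : forall t, measurableType (dW t)}.
Local Notation xfun := ('rV[R]_n -> \bar R).
Variable p : msp n m P W.
Local Notation T := (horizon p).

(** One family is treated abstractly so as to serve both the upper and the lower side. Induction
    runs backward because the selection at [t] is specified only once [F' t.+1] is known to be
    finite, nonempty and inside [G t.+1]. *)
Lemma backward_pass (G F F' : nat -> set xfun)
    (S : nat -> set xfun -> 'rV[R]_n -> xfun) (ST : 'rV[R]_n -> xfun)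
    (z : nat -> 'rV[R]_n) :
  (forall y, Xset p T y -> G T (ST y)) ->
  (forall t A y, (t < T)%N -> finite_set A -> A !=set0 -> A `<=` G t.+1 ->
    Xset p t y -> G t (S t A y)) ->
  (forall t, (t <= T)%N -> Xset p t (z t)) ->
  (forall t, (t <= T)%N -> finite_set (F t) /\ F t `<=` G t) ->
  F' T = F T `|` [set ST (z T)] ->
  (forall t, (t < T)%N -> F' t = F t `|` [set S t (F' t.+1) (z t)]) ->
  forall t, (t <= T)%N -> [/\ finite_set (F' t), F' t !=set0 & F' t `<=` G t].
Proof.
move=> GT GS Xz FG F'T F'S; apply: decreasing_ind => [|t tT [fin' ne' sub']].
  rewrite F'T; have [finF subF] := FG T (leqnn _); split.
  - by rewrite finite_setU; split.
  - by exists (ST (z T)); right.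
  - by move=> phi [/subF //|->]; apply: GT; exact: Xz.
have [finF subF] := FG t (ltnW tT); rewrite (F'S t tT); split.
- by rewrite finite_setU; split.
- by exists (S t (F' t.+1) (z t)); right.
- by move=> phi [/subF //|->]; apply: GS => //; apply: Xz; exact: ltnW.
Qed.

Hypothesis cost_gtNy : forall t (w : W t.+1) (z : 'rV[R]_n * 'rV[R]_m),
  (t < T)%N -> supp p t.+1 w -> (-oo < cost p w z)%E.
Hypothesis noise_finite : forall t, (1 <= t <= T)%N -> finitely_supported p t.
Hypothesis X_compact : forall t, (t <= T)%N -> compact (Xset p t).
Hypothesis init_in : Xset p 0 (init_state p).
Hypothesis U_nonempty : forall t (w : W t.+1) (x : 'rV[R]_n),
  (t < T)%N -> supp p t.+1 w -> Xset p t x -> Uset p w x !=set0.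
Variable LV : nat -> R.
Hypothesis LV_gt0 : forall t, (t <= T)%N -> 0 < LV t.
Variables Fbar Flow : nat -> set xfun.
Hypothesis Fbar_basic : forall t, (t <= T)%N -> Fbar t `<=` basic p LV t.
Hypothesis Flow_basic : forall t, (t <= T)%N -> Flow t `<=` basic p LV t.
Variables (Sbar Slow : nat -> set xfun -> 'rV[R]_n -> xfun).
Variables (SbarT SlowT : 'rV[R]_n -> xfun).
Hypothesis Sbar_sel : forall t, (t < T)%N -> upper_selection p Fbar t (Sbar t).
Hypothesis Slow_sel : forall t, (t < T)%N -> lower_selection p Flow t (Slow t).
Hypothesis SbarT_sel : upper_selection_final p Fbar SbarT.
Hypothesis SlowT_sel : lower_selection_final p Flow SlowT.
Variables (Fb Fl : nat -> nat -> set xfun) (x : nat -> nat -> 'rV[R]_n).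
Hypothesis run : tdp_run p Sbar Slow SbarT SlowT Fb Fl x.

Lemma FbS k t : (t <= T)%N -> exists phi, Fb k.+1 t = Fb k t `|` [set phi].
Proof.
rewrite leq_eqVlt => /predU1P[->|tT].
  by have [-> _] := tdp_backwardT run k; eexists.
by have [-> _] := tdp_backward run k tT; eexists.
Qed.

Lemma FlS k t : (t <= T)%N -> exists phi, Fl k.+1 t = Fl k t `|` [set phi].
Proof.
rewrite leq_eqVlt => /predU1P[->|tT].
  by have [_ ->] := tdp_backwardT run k; eexists.
by have [_ ->] := tdp_backward run k tT; eexists.
Qed.

Lemma Fb_subset k t : (t <= T)%N -> Fb k t `<=` Fb k.+1 t.
Proof. by move=> /(FbS k)[phi ->]; exact: subsetUl. Qed.

Lemma Fl_subset k t : (t <= T)%N -> Fl k t `<=` Fl k.+1 t.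
Proof. by move=> /(FlS k)[phi ->]; exact: subsetUl. Qed.

Lemma Fb_nonempty k t : (t <= T)%N -> Fb k.+1 t !=set0.
Proof. by move=> /(FbS k)[phi ->]; exists phi; right. Qed.

Lemma Fl_nonempty k t : (t <= T)%N -> Fl k.+1 t !=set0.
Proof. by move=> /(FlS k)[phi ->]; exists phi; right. Qed.

(** For positive [k] the controls minimize the lower stage cost, hence are feasible; iteration 0 is
    admissible by convention. The assumption on [Fl k] breaks the circularity with
    [families_finite]. *)
Lemma trajectory_in_of k :
  (forall t, (t <= T)%N -> finite_set (Fl k t) /\ Fl k t `<=` Flow t) ->
  forall t, (t <= T)%N -> Xset p t (x k t).
Proof.
move=> FlP; elim=> [_|t IH tT].
  case: k {FlP} => [|k]; first by rewrite (tdp_forward0 run).1.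
  by rewrite (tdp_forward run (ltn0Sn k)).1.
have Xt := IH (ltnW tT).
case: k FlP {IH} Xt => [_ _|k FlP Xt].
  by have [w [u [_ [_ +] ->]]] := (tdp_forward0 run).2 t tT.
have [u [ws [umin Sws _ ->]]] := (tdp_forward run (ltn0Sn k)).2 t tT.
have [finF subF] := FlP t.+1 tT.
suff [] : Uset p ws (x k.+1 t) (u ws) by [].
apply: (argmin_in_Uset p LV _ _ (sup_of (Fl k.+1 t.+1))); last exact: umin.
- apply: basic_sup_of => //; first exact: Fl_nonempty.
  by apply: subset_trans subF _; exact: Flow_basic.
- exact: U_nonempty.
Qed.

(** Induction on [k]: the lower families keep the trajectory in the state sets, and the backward
    pass along it then yields both families at [k.+1]. *)
Lemma families_finite k :
  (forall t, (t <= T)%N -> finite_set (Fb k t) /\ Fb k t `<=` Fbar t) /\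
  (forall t, (t <= T)%N -> finite_set (Fl k t) /\ Fl k t `<=` Flow t).
Proof.
elim: k => [|k [IHb IHl]].
  by split=> t tT; have [Eb El] := tdp_init run tT; rewrite ?Eb ?El; split.
have Xx := trajectory_in_of k IHl; split=> t tT.
  have [] := backward_pass Fbar (Fb k) (Fb k.+1) Sbar SbarT (x k)
    _ _ Xx IHb _ _ t tT => //.
  - by move=> y /SbarT_sel[].
  - by move=> s A y sT fA A0 AF Xy; have [] := Sbar_sel s sT A y fA A0 AF Xy.
  - exact: (tdp_backwardT run k).1.
  - by move=> s sT; exact: (tdp_backward run k sT).1.
have [] := backward_pass Flow (Fl k) (Fl k.+1) Slow SlowT (x k)
  _ _ Xx IHl _ _ t tT => //.
- by move=> y /SlowT_sel[].
- by move=> s A y sT fA A0 AF Xy; have [] := Slow_sel s sT A y fA A0 AF Xy.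
- exact: (tdp_backwardT run k).2.
- by move=> s sT; exact: (tdp_backward run k sT).2.
Qed.

Lemma trajectory_in k t : (t <= T)%N -> Xset p t (x k t).
Proof. by apply: trajectory_in_of; exact: (families_finite k).2. Qed.

Lemma upper_basic k t : (t <= T)%N -> basic p LV t (inf_of (Fb k.+1 t)).
Proof.
move=> tT; have [fin sub] := (families_finite k.+1).1 t tT.
apply: basic_inf_of => //; first exact: Fb_nonempty.
by apply: subset_trans sub _; exact: Fbar_basic.
Qed.

Lemma lower_basic k t : (t <= T)%N -> basic p LV t (sup_of (Fl k.+1 t)).
Proof.
move=> tT; have [fin sub] := (families_finite k.+1).2 t tT.
apply: basic_sup_of => //; first exact: Fl_nonempty.
by apply: subset_trans sub _; exact: Flow_basic.
Qed.

Lemma upper_selection_run k t : (t < T)%N ->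
  [/\ Fb k.+1 t = Fb k t `|` [set Sbar t (Fb k.+1 t.+1) (x k t)],
      Sbar t (Fb k.+1 t.+1) (x k t) (x k t) =
        bellman p t (inf_of (Fb k.+1 t.+1)) (x k t) &
      forall y, Xset p t y -> (bellman p t (inf_of (Fb k.+1 t.+1)) y <=
        Sbar t (Fb k.+1 t.+1) (x k t) y)%E].
Proof.
move=> tT; have [fin sub] := (families_finite k.+1).1 t.+1 tT.
have [|_ tight valid] := Sbar_sel t tT _ (x k t) fin (Fb_nonempty k _ tT) sub.
  exact/trajectory_in/ltnW.
by split=> //; exact: (tdp_backward run k tT).1.
Qed.

Lemma lower_selection_run k t : (t < T)%N ->
  [/\ Fl k.+1 t = Fl k t `|` [set Slow t (Fl k.+1 t.+1) (x k t)],
      Slow t (Fl k.+1 t.+1) (x k t) (x k t) =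
        bellman p t (sup_of (Fl k.+1 t.+1)) (x k t) &
      forall y, Xset p t y -> (Slow t (Fl k.+1 t.+1) (x k t) y <=
        bellman p t (sup_of (Fl k.+1 t.+1)) y)%E].
Proof.
move=> tT; have [fin sub] := (families_finite k.+1).2 t.+1 tT.
have [|_ tight valid] := Slow_sel t tT _ (x k t) fin (Fl_nonempty k _ tT) sub.
  exact/trajectory_in/ltnW.
by split=> //; exact: (tdp_backward run k tT).2.
Qed.

(** A function selected earlier dominates the Bellman image of an older upper approximation; later
    approximations are smaller, so monotonicity preserves validity. *)
Lemma Fb_valid k t phi y : (t < T)%N -> Fb k t phi -> Xset p t y ->
  (bellman p t (inf_of (Fb k t.+1)) y <= phi y)%E.
Proof.
move=> tT; elim: k => [|k IH]; first by rewrite (tdp_init run (ltnW tT)).1.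
have [-> _ valid] := upper_selection_run k t tT.
move=> [/IH + Xy|-> /valid//] => /(_ Xy); apply: le_trans.
by apply: le_bellman => z; apply: inf_of_subset; exact: Fb_subset.
Qed.

Lemma Fl_valid k t phi y : (t < T)%N -> Fl k t phi -> Xset p t y ->
  (phi y <= bellman p t (sup_of (Fl k t.+1)) y)%E.
Proof.
move=> tT; elim: k => [|k IH]; first by rewrite (tdp_init run (ltnW tT)).2.
have [-> _ valid] := lower_selection_run k t tT.
move=> [/IH + Xy|-> /valid//] => /(_ Xy) /le_trans; apply.
by apply: le_bellman => z; apply: sup_of_subset; exact: Fl_subset.
Qed.

Lemma Fb_valid_final k phi y : Fb k T phi -> Xset p T y ->
  (value p T y <= phi y)%E.
Proof.
elim: k => [|k IH]; first by rewrite (tdp_init run (leqnn T)).1.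
rewrite (tdp_backwardT run k).1 => -[/IH //|->].
by have [_ _] := SbarT_sel _ (trajectory_in k T (leqnn T)); apply.
Qed.

Lemma Fl_valid_final k phi y : Fl k T phi -> Xset p T y ->
  (phi y <= value p T y)%E.
Proof.
elim: k => [|k IH]; first by rewrite (tdp_init run (leqnn T)).2.
rewrite (tdp_backwardT run k).2 => -[/IH //|->].
by have [_ _] := SlowT_sel _ (trajectory_in k T (leqnn T)); apply.
Qed.

(* Comparing the two approximations directly, instead of sandwiching the value
   function between them, avoids computing the domain of the latter. *)
Lemma lower_le_upper k t y : (t <= T)%N ->
  (sup_of (Fl k t) y <= inf_of (Fb k t) y)%E.
Proof.
(* The point [y] is generalized over the whole space, since the Bellman operator evaluates its
   argument at arbitrary successors. *)
move=> tT; move: t tT y; apply: decreasing_ind => [|t tT IH] y;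
    apply: le_ereal_inf_tmp => _ [phi Fphi <-];
    apply: ge_ereal_sup => _ [psi Fpsi <-].
  have [Xy|Xy] := pselect (Xset p T y).
    exact: le_trans (Fl_valid_final k _ _ Fpsi Xy)
      (Fb_valid_final k _ _ Fphi Xy).
  have [_ /(_ _ Fphi) Gphi] := (families_finite k).1 T (leqnn T).
  by rewrite (Fbar_basic T (leqnn T) _ Gphi).2// leey.
have [Xy|Xy] := pselect (Xset p t y).
  apply: le_trans (Fl_valid k t _ _ tT Fpsi Xy) _.
  apply: le_trans (Fb_valid k t _ _ tT Fphi Xy).
  exact: le_bellman.
have [_ /(_ _ Fphi) Gphi] := (families_finite k).1 t (ltnW tT).
by rewrite (Fbar_basic t (ltnW tT) _ Gphi).2// leey.
Qed.

(** * The gap between the two approximations *)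

(* Shifted by one since the families are empty at iteration 0. *)
Let gap k t y : R := fine (inf_of (Fb k.+1 t) y) - fine (sup_of (Fl k.+1 t) y).

Lemma upper_fin k t y : (t <= T)%N -> Xset p t y ->
  inf_of (Fb k.+1 t) y \is a fin_num.
Proof. by move=> tT; exact: basic_fin_num (upper_basic k t tT). Qed.

Lemma lower_fin k t y : (t <= T)%N -> Xset p t y ->
  sup_of (Fl k.+1 t) y \is a fin_num.
Proof. by move=> tT; exact: basic_fin_num (lower_basic k t tT). Qed.

Lemma gapE k t y : (t <= T)%N -> Xset p t y ->
  (inf_of (Fb k.+1 t) y - sup_of (Fl k.+1 t) y)%E = (gap k t y)%:E.
Proof.
by move=> tT Xy; rewrite EFinB !fineK//; [exact: lower_fin|exact: upper_fin].
Qed.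

Lemma upperE k t y : (t <= T)%N -> Xset p t y ->
  inf_of (Fb k.+1 t) y = (sup_of (Fl k.+1 t) y + (gap k t y)%:E)%E.
Proof. by move=> tT Xy; rewrite -gapE// addeC subeK// lower_fin. Qed.

Lemma gap_le k t y (r : R) : (t <= T)%N -> Xset p t y ->
  (inf_of (Fb k.+1 t) y <= sup_of (Fl k.+1 t) y + r%:E)%E -> gap k t y <= r.
Proof.
by move=> tT Xy; rewrite upperE// leeD2lE ?lower_fin// lee_fin.
Qed.

Lemma gap_ge0 k t y : (t <= T)%N -> Xset p t y -> 0 <= gap k t y.
Proof.
move=> tT Xy; rewrite subr_ge0 fine_le ?lower_le_upper//.
  exact: lower_fin.
exact: upper_fin.
Qed.

Lemma gap_lip k t y z : (t <= T)%N -> Xset p t y -> Xset p t z ->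
  gap k t y <= gap k t z + 2 * LV t * enorm (y - z).
Proof.
move=> tT Xy Xz; rewrite /gap.
have := basic_lip p LV t _ y z (upper_basic k t tT) Xy Xz.
have := basic_lip p LV t _ z y (lower_basic k t tT) Xz Xy.
rewrite (enormB z y); lra.
Qed.

Lemma gap_decr k t y : (t <= T)%N -> Xset p t y -> gap k.+1 t y <= gap k t y.
Proof.
move=> tT Xy; rewrite lerB// fine_le//.
- exact: upper_fin.
- exact: upper_fin.
- by apply: inf_of_subset; exact: Fb_subset.
- exact: lower_fin.
- exact: lower_fin.
- by apply: sup_of_subset; exact: Fl_subset.
Qed.

(** Both selections made at [x k.+1 T] take the final value there, and both already belong to the
    families of index [k.+2] that [gap k.+1] measures. *)
Lemma gap_final k : gap k.+1 T (x k.+1 T) <= 0.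
Proof.
have XT := trajectory_in k.+1 T (leqnn T).
apply: gap_le => //; rewrite adde0.
have [_ Eb _] := SbarT_sel _ XT; have [_ El _] := SlowT_sel _ XT.
apply: (@le_trans _ _ (value p T (x k.+1 T))).
  by rewrite -Eb; apply: inf_of_le; rewrite (tdp_backwardT run k.+1).1; right.
by rewrite -El; apply: sup_of_ge; rewrite (tdp_backwardT run k.+1).2; right.
Qed.

Lemma gap_step k t : (t < T)%N ->
  gap k.+1 t (x k.+1 t) <= gap k t.+1 (x k.+1 t.+1).
Proof.
move=> tT; have tT' := ltnW tT.
have Xt := trajectory_in k.+1 t tT'.
have [FbE tightb _] := upper_selection_run k.+1 t tT.
have [FlE tightl _] := lower_selection_run k.+1 t tT.
apply: gap_le => //.
apply: (@le_trans _ _ (bellman p t (inf_of (Fb k.+1 t.+1)) (x k.+1 t))).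
  (* Tightness involves the families of index [k.+2], but the trajectory [x k.+1] was computed from
     those of index [k.+1]; monotonicity bridges the two. *)
  apply: (@le_trans _ _ (bellman p t (inf_of (Fb k.+2 t.+1)) (x k.+1 t))).
    by rewrite -tightb FbE; apply: inf_of_le; right.
  by apply: le_bellman => y; apply: inf_of_subset; exact: Fb_subset.
apply: (@le_trans _ _ (bellman p t (sup_of (Fl k.+1 t.+1)) (x k.+1 t) +
    (gap k t.+1 (x k.+1 t.+1))%:E)%E); last first.
  apply: leeD2r.
  apply: (@le_trans _ _ (bellman p t (sup_of (Fl k.+2 t.+1)) (x k.+1 t))).
    by apply: le_bellman => y; apply: sup_of_subset; exact: Fl_subset.
  by rewrite -tightl FlE; apply: sup_of_ge; right.
have [u [ws [umin Sws wmax xE]]] := (tdp_forward run (ltn0Sn k)).2 t tT.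
apply: (bellman_le_add p LV t _ _ _ u).
- exact: noise_finite.
- by move=> w; exact: cost_gtNy.
- exact: upper_basic.
- exact: lower_basic.
- move=> w Sw; apply: (argmin_in_Uset p LV _ _ (sup_of (Fl k.+1 t.+1))).
  + exact: lower_basic.
  + exact: U_nonempty.
  + exact: umin.
- exact: umin.
(* The chosen noise maximizes the gap over the support, and its successor is [x k.+1 t.+1]. *)
- move=> w Sw; apply: le_trans (wmax w Sw) _.
  by rewrite -xE gapE//; exact: trajectory_in.
Qed.

(** * Convergence along trajectories and at accumulation points *)

Lemma gap_trajectory_cvg0 t : (t <= T)%N ->
  gap k t (x k.+1 t) @[k --> \oo] --> (0 : R).
Proof.
(* The trajectory is shifted as well: [x k.+1] is computed from the very families in [gap k]. The
   constant adds those of the upper and lower approximations. *)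
apply: (gap_cvg0 T (Xset p) (fun t => 2 * LV t) gap (fun k => x k.+1)).
- exact: X_compact.
- by move=> s sT; rewrite mulr_gt0// LV_gt0.
- exact: gap_lip.
- exact: gap_ge0.
- exact: gap_decr.
- by move=> k s; exact: trajectory_in.
- exact: gap_final.
- exact: gap_step.
Qed.

Lemma tdp_gap_cvg0 t : (t <= T)%N ->
  (inf_of (Fb k t) (x k t) - sup_of (Fl k t) (x k t))%E @[k --> \oo] --> 0%E.
Proof.
move=> tT; rewrite -cvg_shiftS.
apply: (cvg_trans (G := (gap k t (x k.+1 t))%:E @[k --> \oo])).
  apply: near_eq_cvg; apply: nearW => k /=.
  by rewrite gapE//; exact: trajectory_in.
by apply: cvg_EFin; [exact: nearW|exact: gap_trajectory_cvg0].
Qed.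

Lemma tdp_limits_eq t xs : (t <= T)%N -> cluster (x k t @[k --> \oo]) xs ->
  limn (fun k => inf_of (Fb k t) xs) = limn (fun k => sup_of (Fl k t) xs).
Proof.
move=> tT /cluster_seq_frequently xsP.
have Xxs : Xset p t xs.
  (* The accumulation point stays in the state set, which is closed as a compact set in a Hausdorff
     space. *)
  have /closure_id -> : closed (Xset p t).
    by apply: compact_closed; [exact: norm_hausdorff|exact: X_compact].
  move=> B /(xsP 0%N)[k _ Bk]; exists (x k t); split=> //.
  exact: trajectory_in.
have gap0 e : 0 < e -> exists k, gap k t xs < e.
  apply: (@cluster_seq_cvg0 _ _ (Xset p t) (2 * LV t) (fun k => gap k t) _ _ _
    (fun k => x k.+1 t)) => //.
  - by rewrite mulr_gt0// LV_gt0.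
  - by move=> k y z; exact: gap_lip.
  - by move=> k y; exact: gap_ge0.
  - by move=> k; exact: trajectory_in.
  - exact: gap_trajectory_cvg0.
  (* Asking for an index at least [N.+1] makes it a successor, as the shifted sequence requires. *)
  - by move=> N B /(xsP N.+1)[[|k]// Nk Bk]; exists k.
have ni : {homo (fun k => inf_of (Fb k t) xs) :
    j k / (j <= k)%N >-> (k <= j)%E}.
  apply/nonincreasing_seqP => k; apply: inf_of_subset; exact: Fb_subset.
have nd : {homo (fun k => sup_of (Fl k t) xs) :
    j k / (j <= k)%N >-> (j <= k)%E}.
  apply/nondecreasing_seqP => k; apply: sup_of_subset; exact: Fl_subset.
(* By monotonicity the two limits are an infimum and a supremum over [k], so a single index with a
   small gap suffices for one inequality. *)
rewrite (cvg_lim _ (ereal_nonincreasing_cvgn ni))//.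
rewrite (cvg_lim _ (ereal_nondecreasing_cvgn nd))//.
apply/eqP; rewrite eq_le; apply/andP; split.
  apply/lee_addgt0Pr => e e0; have [k ke] := gap0 e e0.
  apply: (@le_trans _ _ (inf_of (Fb k.+1 t) xs)).
    by apply: ereal_inf_lbound; exists k.+1.
  rewrite upperE//; apply: leeD; last by rewrite lee_fin ltW.
  by apply: ereal_sup_ubound; exists k.+1.
apply: ge_ereal_sup => _ [j _ <-]; apply: le_ereal_inf_tmp => _ [k _ <-].
(* Approximations of different indices are compared at the larger index. *)
apply: le_trans (nd _ _ (leq_maxl j k)) _.
apply: le_trans (ni _ _ (leq_maxr j k)).
exact: lower_le_upper.
Qed.

End tdp.

Theorem theorem10 (R : realType) (n m : nat)
  (d : measure_display) (Omega : measurableType d) (P : probability Omega R)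
  (dW : nat -> measure_display) (W : forall t : nat, measurableType (dW t))
  (p : msp n m P W)
  (horizon_ge1 : (1 <= horizon p)%N)
  (cost_gtNy : forall (t : nat) (w : W t.+1) (z : 'rV[R]_n * 'rV[R]_m),
     (t < horizon p)%N -> supp p t.+1 w -> (-oo < cost p w z)%E)
  (final_cost_gtNy : forall x : 'rV[R]_n, (-oo < final_cost p x)%E)
  (* (1) *)
  (noise_indep : independent_noises p)
  (noise_finite : forall t : nat, (1 <= t <= horizon p)%N ->
     finitely_supported p t)
  (* (2) *)
  (X_nonempty : forall t : nat, (t <= horizon p)%N -> Xset p t !=set0)
  (X_compact : forall t : nat, (t <= horizon p)%N -> compact (Xset p t))
  (init_in : Xset p 0 (init_state p))
  (* (3) *)
  (dyn_lip : forall (t : nat) (w : W t.+1),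
     (t < horizon p)%N -> supp p t.+1 w ->
     exists L : R, lipschitz_on2 L (edom (cost p w)) (dyn p w))
  (cost_lip : forall (t : nat) (w : W t.+1),
     (t < horizon p)%N -> supp p t.+1 w ->
     exists L : R, elipschitz_on (@enorm2 R n m) L (edom (cost p w)) (cost p w))
  (U_lip : forall (t : nat) (w : W t.+1),
     (t < horizon p)%N -> supp p t.+1 w ->
     exists L : R, 0 < L /\
       forall x1 x2 : 'rV[R]_n, Xset p t x1 -> Xset p t x2 ->
       (hausdorff_dist (Uset p w x1) (Uset p w x2)
          <= (L * enorm (x1 - x2))%:E)%E)
  (final_cost_lip : exists L : R,
     elipschitz_on (@enorm R n) L (Xset p (horizon p)) (final_cost p))
  (* (4) *)
  (U_nonempty : forall (t : nat) (w : W t.+1) (x : 'rV[R]_n),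
     (t < horizon p)%N -> supp p t.+1 w -> Xset p t x -> Uset p w x !=set0)
  (U_compact : forall (t : nat) (w : W t.+1) (x : 'rV[R]_n),
     (t < horizon p)%N -> supp p t.+1 w -> Xset p t x -> compact (Uset p w x))
  (* Lipschitz constants of the value functions *)
  (LV : nat -> R)
  (LV_gt0 : forall t : nat, (t <= horizon p)%N -> 0 < LV t)
  (value_lip : forall t : nat, (t <= horizon p)%N ->
     elipschitz_on (@enorm R n) (LV t) (Xset p t) (value p t))
  (* basic functions and selection functions *)
  (Fbar Flow : nat -> set ('rV[R]_n -> \bar R))
  (Fbar_basic : forall t : nat, (t <= horizon p)%N -> Fbar t `<=` basic p LV t)
  (Flow_basic : forall t : nat, (t <= horizon p)%N -> Flow t `<=` basic p LV t)
  (Sbar Slow :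
     nat -> set ('rV[R]_n -> \bar R) -> 'rV[R]_n -> ('rV[R]_n -> \bar R))
  (SbarT SlowT : 'rV[R]_n -> ('rV[R]_n -> \bar R))
  (Sbar_sel : forall t : nat, (t < horizon p)%N ->
     upper_selection p Fbar t (Sbar t))
  (Slow_sel : forall t : nat, (t < horizon p)%N ->
     lower_selection p Flow t (Slow t))
  (SbarT_sel : upper_selection_final p Fbar SbarT)
  (SlowT_sel : lower_selection_final p Flow SlowT)
  (* a run of TDP *)
  (Fb Fl : nat -> nat -> set ('rV[R]_n -> \bar R))
  (x : nat -> nat -> 'rV[R]_n)
  (run : tdp_run p Sbar Slow SbarT SlowT Fb Fl x) :
  forall t : nat, (t <= horizon p)%N ->
    ((inf_of (Fb k t) (x k t) - sup_of (Fl k t) (x k t))%E @[k --> \oo]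
       --> 0%E) /\
    (forall xs : 'rV[R]_n, cluster (x k t @[k --> \oo]) xs ->
       limn (fun k => inf_of (Fb k t) xs) = limn (fun k => sup_of (Fl k t) xs)).
Proof.
move=> t tT; split.
  exact: (tdp_gap_cvg0 p cost_gtNy noise_finite X_compact init_in U_nonempty LV
    LV_gt0 Fbar Flow Fbar_basic Flow_basic Sbar Slow SbarT SlowT Sbar_sel
    Slow_sel SbarT_sel SlowT_sel Fb Fl x run t tT).
move=> xs.
exact: (tdp_limits_eq p cost_gtNy noise_finite X_compact init_in U_nonempty LV
  LV_gt0 Fbar Flow Fbar_basic Flow_basic Sbar Slow SbarT SlowT Sbar_sel
  Slow_sel SbarT_sel SlowT_sel Fb Fl x run t xs tT).
Qed.
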